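(* Let $\mathcal{H}$ be a finite-dimensional Hilbert space, $\{\rho_\theta;\theta\in\Theta\subset\mathbb{R}^d\}$ a smooth family of density operators, $\theta_0\in\Theta$ with $\rho=\rho_{\theta_0}$ strictly positive, and suppose there exists a $(d+1)$-dimensional real subspace $\tilde{\mathcal{T}}$ of Hermitian operators with $\operatorname{span}_{\mathbb{R}}\{L_i^{(S)}\}_{i=1}^d\subset\tilde{\mathcal{T}}$ and $\mathcal{D}_\rho(\tilde{\mathcal{T}})\subset\tilde{\mathcal{T}}$. Let $G$ be a $d\times d$ real positive matrix and define $$\hat\beta=\begin{cases}\dfrac{\operatorname{Tr}\big|\sqrt G\,\operatorname{Im}(J^{(R)}_{\theta_0})^{-1}\sqrt G\big|}{2\operatorname{Tr}G\{(J^{(S)}_{\theta_0})^{-1}-\operatorname{Re}((J^{(R)}_{\theta_0})^{-1})\}}&\text{if }(J^{(S)}_{\theta_0})^{-1}\ne\operatorname{Re}((J^{(R)}_{\theta_0})^{-1}),\\ \infty&\text{otherwise.}\end{cases}$$ Then $$\max_{0\le\beta\le1}C^{(\beta)}_{\theta_0,G}=\begin{cases}C^{(1)}_{\theta_0,G}&\text{if }\hat\beta\ge1,\\ C^{(\hat\beta)}_{\theta_0,G}&\text{otherwise.}\end{cases}$$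
   Context: $\partial_i\rho=\frac{\partial}{\partial\theta^i}\rho_\theta|_{\theta=\theta_0}$. Commutation operator: $\mathcal{D}_\rho(X)\rho+\rho\mathcal{D}_\rho(X)=\sqrt{-1}(X\rho-\rho X)$. For $\beta\in[0,1]$, the $\beta$ logarithmic derivatives $L_i^{(\beta)}$ are defined by $\partial_i\rho=\frac{1+\beta}{2}\rho L_i^{(\beta)}+\frac{1-\beta}{2}L_i^{(\beta)}\rho$; $L_i^{(S)}=L_i^{(0)}$ (SLD, assumed linearly independent), $L_i^{(R)}=L_i^{(1)}$ (RLD). $J^{(\beta)}_{\theta_0}=[\operatorname{Tr}\partial_i\rho\,L_j^{(\beta)}]_{ij}$, $J^{(S)}_{\theta_0}=J^{(0)}_{\theta_0}$, $J^{(R)}_{\theta_0}=J^{(1)}_{\theta_0}$, and $C^{(\beta)}_{\theta_0,G}=\operatorname{Tr}G(J^{(\beta)}_{\theta_0})^{-1}+\operatorname{Tr}|\sqrt G\,\operatorname{Im}(J^{(\beta)}_{\theta_0})^{-1}\sqrt G|$. Re, Im entrywise; $|X|=(X^*X)^{1/2}$. *)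

(* Defs.v *)
From HB Require Import structures.
From mathcomp Require Import all_boot all_order all_algebra.
From mathcomp Require Import all_classical all_reals all_analysis.
From mathcomp Require Import complex.
Set Implicit Arguments. Unset Strict Implicit. Unset Printing Implicit Defensive.
Import Order.TTheory GRing.Theory Num.Theory.
Local Open Scope ring_scope.
Local Open Scope complex_scope.

Section QDefs.
Variable R : realType.

Definition cmx m n (A : 'M[R]_(m, n)) : 'M[R[i]]_(m, n) := map_mx (fun x => x +i* 0) A.
Definition ReM m n (A : 'M[R[i]]_(m, n)) : 'M[R]_(m, n) := map_mx (@complex.Re R) A.
Definition ImM m n (A : 'M[R[i]]_(m, n)) : 'M[R]_(m, n) := map_mx (@complex.Im R) A.
Definition mxadj m n (A : 'M[R[i]]_(m, n)) : 'M[R[i]]_(n, m) := (map_mx conjc A)^T.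

Definition is_hermitian n (A : 'M[R[i]]_n) : Prop := mxadj A = A.
(* strictly positive (positive definite) operator; order on R[i]: 0 < z iff z real > 0 *)
Definition pos_def n (A : 'M[R[i]]_n) : Prop :=
  is_hermitian A /\ forall x : 'cV[R[i]]_n, x != 0 -> 0 < (mxadj x *m A *m x) 0 0.
Definition density n (A : 'M[R[i]]_n) : Prop :=
  [/\ is_hermitian A, (forall x : 'cV[R[i]]_n, 0 <= (mxadj x *m A *m x) 0 0) & \tr A = 1].

Definition rsym n (A : 'M[R]_n) : Prop := A^T = A.
Definition rpsd n (A : 'M[R]_n) : Prop :=
  rsym A /\ forall x : 'cV[R]_n, 0 <= (x^T *m A *m x) 0 0.
Definition rpos_def n (A : 'M[R]_n) : Prop :=
  rsym A /\ forall x : 'cV[R]_n, x != 0 -> 0 < (x^T *m A *m x) 0 0.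
Definition sqrtm n (A : 'M[R]_n) : 'M[R]_n := xget 0 [set S | rpsd S /\ S *m S = A].
Definition trabs n (X : 'M[R]_n) : R := \tr (sqrtm (X^T *m X)).

Definition in_rspan n k (B : 'I_k -> 'M[R[i]]_n) (X : 'M[R[i]]_n) : Prop :=
  exists c : 'I_k -> R, X = \sum_(j < k) (c j +i* 0) *: B j.
Definition rfree n k (B : 'I_k -> 'M[R[i]]_n) : Prop :=
  forall c : 'I_k -> R, \sum_(j < k) (c j +i* 0) *: B j = 0 -> forall j, c j = 0.

Definition pderiv n d (rho : 'rV[R]_d -> 'M[R[i]]_n) (theta0 : 'rV[R]_d) (k : 'I_d)
  : 'M[R[i]]_n :=
  \matrix_(a, b) ('D_(delta_mx 0 k) (fun th => complex.Re (rho th a b)) theta0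
                  +i* 'D_(delta_mx 0 k) (fun th => complex.Im (rho th a b)) theta0).

Definition betaLD n (rho drho : 'M[R[i]]_n) (beta : R) : 'M[R[i]]_n :=
  xget 0 [set L | drho = ((1 + beta) / 2 +i* 0) *: (rho *m L)
                         + ((1 - beta) / 2 +i* 0) *: (L *m rho)].

Definition commop n (rho X : 'M[R[i]]_n) : 'M[R[i]]_n :=
  xget 0 [set Y | Y *m rho + rho *m Y = 'i *: (X *m rho - rho *m X)].

Definition Jbeta n d (rho : 'M[R[i]]_n) (D : 'I_d -> 'M[R[i]]_n) (beta : R)
  : 'M[R[i]]_d :=
  \matrix_(i, j) \tr (D i *m betaLD rho (D j) beta).

Definition Cbeta n d (rho : 'M[R[i]]_n) (D : 'I_d -> 'M[R[i]]_n) (G : 'M[R]_d)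
  (beta : R) : R :=
  let Ji := invmx (Jbeta rho D beta) in
  complex.Re (\tr (cmx G *m Ji)) + trabs (sqrtm G *m ImM Ji *m sqrtm G).

Definition betahat n d (rho : 'M[R[i]]_n) (D : 'I_d -> 'M[R[i]]_n) (G : 'M[R]_d)
  : \bar R :=
  let JSi := invmx (Jbeta rho D 0) in
  let JRi := invmx (Jbeta rho D 1) in
  if JSi != cmx (ReM JRi) then
    ((trabs (sqrtm G *m ImM JRi *m sqrtm G))
       / (2 * complex.Re (\tr (cmx G *m (JSi - cmx (ReM JRi))))))%:E
  else +oo%E.

End QDefs.

(* Main.v *)
(** For the SLD inner product [<X, Y> = Re Tr (S X) Y] with
    [S X = (rho X + X rho) / 2], the commutation operator is skew and the
    [beta]-product is [S (1 + i beta D_rho)], so that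
    [J^(beta) = <L_i, (1 + i beta D_rho)^-1 L_j>].  In the invariant space
    the SLDs miss a single direction [e]; eliminating it gives
    [(J^(beta))^-1 = (J^(S))^-1 + i beta F - beta^2 t g g^T] with [F], [g] real
    and [t = <e, e> > 0].  Hence [C^(beta)] is the concave quadratic
    [Tr G (J^(S))^-1 - beta^2 t (g^T G g) + beta Tr |sqrt G F sqrt G|],
    whose vertex is [beta-hat]. *)
Require Import Defs.
From HB Require Import structures.
From mathcomp Require Import all_boot all_order all_algebra.
From mathcomp Require Import all_classical all_reals all_analysis.
From mathcomp Require Import complex ring lra.
Import Order.TTheory GRing.Theory Num.Theory.
Local Open Scope ring_scope.
Local Open Scope classical_set_scope.

(** * Real positive semidefinite matrices, their square roots and the trace norm *)

Section RealPSD.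
Variable R : realType.
Implicit Types (n : nat) (a : R).

Lemma diag_quadE n m (Z : 'M[R]_(n, m)) (W : 'M[R]_n) j :
  (Z^T *m W *m Z) j j = ((col j Z)^T *m W *m col j Z) 0 0.
Proof.
rewrite !colE trmx_mul trmx_delta !mulmxA -colE -!mulmxA -rowE.
by rewrite [in RHS]mxE [in RHS]mxE !mulmxA.
Qed.

(** With [y = S *m x], the form at [y - a *: x] is affine in [a] with slope [-2 |y|^2]; being
    nonnegative for all real [a] forces [y = 0]. *)
Lemma rpsd_quad0 n (S : 'M[R]_n) (x : 'cV[R]_n) :
  rpsd S -> (x^T *m S *m x) 0 0 = 0 -> S *m x = 0.
Proof.
move=> [symS posS] qx0; set y := S *m x.
have qD a : ((y - a *: x)^T *m S *m (y - a *: x)) 0 0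
    = (y^T *m S *m y) 0 0 - 2 * a * (y^T *m y) 0 0.
  have xS : x^T *m S = y^T by rewrite /y trmx_mul symS.
  have -> : (y - a *: x)^T *m S *m (y - a *: x)
      = y^T *m S *m y - (2 * a) *: (y^T *m y) + (a * a) *: (y^T *m x).
    rewrite [(_ - _)^T]linearB /= [(_ *: _)^T]linearZ /= mulmxBl mulmxBr !mulmxBl.
    rewrite -!scalemxAl -!scalemxAr xS -[y^T *m S *m x]mulmxA -/y scalerA.
    move: (y^T *m S *m y) (y^T *m y) (y^T *m x) => P Q T.
    by apply/matrixP => i j; rewrite !mxE; ring.
  have {}qx0 : (y^T *m x) 0 0 = 0 by rewrite -xS.
  move: (y^T *m S *m y) (y^T *m y) (y^T *m x) qx0 => P Q T qx0.
  by rewrite !mxE qx0; ring.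
have yy0 : (y^T *m y) 0 0 = 0.
  set p := (y^T *m S *m y) 0 0 in qD; set q := (y^T *m y) 0 0 in qD *.
  have q_ge0 : 0 <= q.
    by rewrite /q mxE; apply: sumr_ge0 => k _; rewrite !mxE -expr2 sqr_ge0.
  apply/eqP; rewrite eq_le q_ge0 andbT leNgt; apply/negP => q_gt0.
  (* This value of [a] brings the form down to [p - (p + 1) = -1]. *)
  have := posS (y - ((p + 1) / (2 * q)) *: x); rewrite qD.
  have -> : 2 * ((p + 1) / (2 * q)) * q = p + 1 by field; rewrite gt_eqF.
  lra.
apply/matrixP => i j; rewrite (ord1 j) [RHS]mxE.
move: yy0; rewrite mxE => /eqP; rewrite psumr_eq0; last first.
  by move=> k _; rewrite !mxE -expr2 sqr_ge0.
by move=> /allP /(_ i (mem_index_enum _)); rewrite !mxE /= -expr2 sqrf_eq0 => /eqP.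
Qed.

Lemma rsym_sqr0 n (Z : 'M[R]_n) : rsym Z -> Z *m Z = 0 -> Z = 0.
Proof.
move=> symZ ZZ0; apply/matrixP => i j; rewrite [RHS]mxE.
have : (Z^T *m Z) j j = 0 by rewrite symZ ZZ0 mxE.
rewrite mxE => /eqP; rewrite psumr_eq0; last first.
  by move=> k _; rewrite !mxE -expr2 sqr_ge0.
by move=> /allP /(_ i (mem_index_enum _)); rewrite !mxE /= -expr2 sqrf_eq0 => /eqP.
Qed.

(* With [Z = S - T] and [W = S + T], [ZW + WZ = 0], so [tr (ZWZ) = 0]: every
   column of [Z] annihilates the quadratic forms of both [S] and [T]. *)
Lemma rpsd_sqr_inj n (S T : 'M[R]_n) :
  rpsd S -> rpsd T -> S *m S = T *m T -> S = T.
Proof.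
move=> psdS psdT eqST; have [[symS posS] [symT posT]] := (psdS, psdT).
set Z := S - T; have symZ : rsym Z by rewrite /rsym /Z linearB /= symS symT.
have ZW : Z *m (S + T) = - ((S + T) *m Z).
  rewrite /Z mulmxBl mulmxDl !mulmxBr !mulmxDr eqST.
  move: (S *m T) (T *m S) (T *m T) => P Q V.
  by apply/matrixP => i j; rewrite !mxE; ring.
have tr0 : \tr (Z^T *m (S + T) *m Z) = 0.
  have : \tr (Z *m (S + T) *m Z) = - \tr (Z *m (S + T) *m Z).
    by rewrite {1}ZW mulNmx linearN /= [in LHS]mxtrace_mulC mulmxA.
  rewrite symZ; lra.
have colZ j : S *m col j Z = 0 /\ T *m col j Z = 0.
  have trD : \tr (Z^T *m (S + T) *m Z) =
      \sum_j (((col j Z)^T *m S *m col j Z) 0 0 + ((col j Z)^T *m T *m col j Z) 0 0).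
    by apply: eq_bigr => k _; rewrite diag_quadE mulmxDr mulmxDl mxE.
  move: tr0; rewrite trD => /eqP; rewrite psumr_eq0; last first.
    by move=> k _; apply: addr_ge0.
  move=> /allP /(_ j (mem_index_enum _)) /=.
  by rewrite paddr_eq0 // => /andP[/eqP qS /eqP qT]; split; apply: rpsd_quad0.
have ZZ0 : Z *m Z = 0.
  apply/matrixP => i j; have [cS cT] := colZ j.
  have : col j (Z *m Z) = 0 by rewrite colE -mulmxA -colE mulmxBl cS cT subr0.
  by move=> /matrixP /(_ i 0); rewrite !mxE.
by apply/eqP; rewrite -subr_eq0; apply/eqP/rsym_sqr0.
Qed.

Lemma rpsdZ n a (S : 'M[R]_n) : 0 <= a -> rpsd S -> rpsd (a *: S).
Proof.
move=> a_ge0 [symS posS]; split; first by rewrite /rsym linearZ /= symS.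
by move=> x; rewrite -scalemxAr -scalemxAl mxE mulr_ge0.
Qed.

Lemma rpsd_tr_ge0 n (S : 'M[R]_n) : rpsd S -> 0 <= \tr S.
Proof.
move=> [_ posS]; apply: sumr_ge0 => i _.
by rewrite -[S]mulmx1 -[S]mul1mx -{1}trmx1 diag_quadE.
Qed.

Lemma rpsd0 n : rpsd (0 : 'M[R]_n).
Proof. by split=> [|x]; rewrite ?/rsym ?trmx0 // mulmx0 mul0mx mxE. Qed.

(** Uniqueness of the positive semidefinite root makes any exhibited root the one chosen by
    [xget]. *)
Lemma sqrtm_eq n (S A : 'M[R]_n) : rpsd S -> S *m S = A -> sqrtm A = S.
Proof.
move=> psdS SS; apply: xget_unique => // T [psdT TT].
by apply: rpsd_sqr_inj; rewrite // TT SS.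
Qed.

(** When there is no root, [xget] returns its default 0, itself positive semidefinite. *)
Lemma rpsd_sqrtm n (A : 'M[R]_n) : rpsd (sqrtm A).
Proof. by rewrite /sqrtm; case: xgetP => [S _ [] //|_]; apply: rpsd0. Qed.

(** Roots scale by [a]. For [a > 0], if [A] has no root then neither has [a ^+ 2 *: A], and both
    sides are the default 0. *)
Lemma sqrtmZ n a (A : 'M[R]_n) : 0 <= a -> sqrtm (a ^+ 2 *: A) = a *: sqrtm A.
Proof.
rewrite le0r => /predU1P[->|a_gt0].
  by rewrite expr0n !scale0r; apply: sqrtm_eq (rpsd0 n) _; rewrite mulmx0.
rewrite [in RHS]/sqrtm; case: xgetP => [S _ [psdS SS]|noS].
  apply: sqrtm_eq; first by apply: rpsdZ => //; apply: ltW.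
  by rewrite -scalemxAr -scalemxAl scalerA SS.
rewrite scaler0; apply: xgetPN => T [psdT TT]; apply: (noS (a^-1 *: T)); split.
  by apply: rpsdZ => //; rewrite invr_ge0 ltW.
rewrite -scalemxAr -scalemxAl TT !scalerA.
by rewrite (_ : _ * _ = 1) ?scale1r //; field; rewrite gt_eqF.
Qed.

Lemma trabs_ge0 n (X : 'M[R]_n) : 0 <= trabs X.
Proof. exact/rpsd_tr_ge0/rpsd_sqrtm. Qed.

Lemma trabsZ n a (X : 'M[R]_n) : 0 <= a -> trabs (a *: X) = a * trabs X.
Proof.
move=> a_ge0; rewrite /trabs [(_ *: _)^T]linearZ /= -scalemxAr -scalemxAl scalerA -expr2.
by rewrite sqrtmZ // linearZ.
Qed.

End RealPSD.

(** * The beta-product, the SLD inner product and the commutation operator *)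

Section BetaProduct.
Set Implicit Arguments. Unset Strict Implicit. Unset Printing Implicit Defensive.
Local Open Scope complex_scope.
Variable R : realType.
Local Notation C := (R[i]).
Local Notation im := (0 +i* 1 : C).

Lemma mxadjM m n p (A : 'M[C]_(m, n)) (B : 'M[C]_(n, p)) :
  mxadj (A *m B) = mxadj B *m mxadj A.
Proof. by rewrite /mxadj map_mxM trmx_mul. Qed.

Lemma mxadjK m n (A : 'M[C]_(m, n)) : mxadj (mxadj A) = A.
Proof. by apply/matrixP => i j; rewrite !mxE conjcK. Qed.

Lemma mxtrace_mxadj n (A : 'M[C]_n) : \tr (mxadj A) = (\tr A)^*.
Proof.
by rewrite /mxtrace rmorph_sum; apply: eq_bigr => i _; rewrite !mxE.
Qed.

Lemma mxadj_rsum n k (c : 'I_k -> R) (B : 'I_k -> 'M[C]_n) :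
  (forall j, is_hermitian (B j)) ->
  is_hermitian (\sum_(j < k) (c j)%:C *: B j).
Proof.
move=> herB; apply/matrixP => a b; rewrite !mxE !summxE rmorph_sum.
apply: eq_bigr => j _; rewrite !mxE rmorphM /= -{2}(herB j) !mxE.
by congr (_ * _); rewrite oppr0.
Qed.

Section Fixed.
Variables (n : nat) (rho : 'M[C]_n).
Hypothesis rho_gt0 : pos_def rho.
Implicit Types (X Y : 'M[C]_n) (b : R).

(** The linear map that the beta logarithmic derivative inverts. *)
Definition betaprod b X : 'M[C]_n :=
  ((1 + b) / 2)%:C *: (rho *m X) + ((1 - b) / 2)%:C *: (X *m rho).

Lemma betaprod_is_linear b : linear (betaprod b).
Proof.
move=> a X Y; rewrite /betaprod mulmxDr mulmxDl -scalemxAr -scalemxAl.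
by apply/matrixP => i j; rewrite !mxE; ring.
Qed.

HB.instance Definition _ b :=
  GRing.isLinear.Build C 'M[C]_n 'M[C]_n _ (betaprod b) (betaprod_is_linear b).

Lemma tr_pos_def m (X : 'M[C]_(n, m)) :
  X != 0 -> 0 < \tr (mxadj X *m rho *m X).
Proof.
have [_ pos] := rho_gt0.
have diagE j : (mxadj X *m rho *m X) j j
    = (mxadj (col j X) *m rho *m col j X) 0 0.
  have -> : mxadj (col j X) = row j (mxadj X).
    by apply/matrixP => a b; rewrite !mxE.
  by rewrite colE rowE !mulmxA -colE -!mulmxA -rowE [in RHS]mxE [in RHS]mxE !mulmxA.
have ge0 j : 0 <= (mxadj X *m rho *m X) j j.
  rewrite diagE; have [->|/pos/ltW //] := eqVneq (col j X) 0.
  by rewrite mulmx0 mxE.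
move=> X_neq0.
have [j colj] : exists j, col j X != 0.
  apply/existsP; apply: contraNT X_neq0; rewrite negb_exists => /forallP col0.
  apply/eqP/matrixP => a j; have /negPn/eqP/matrixP/(_ a 0) := col0 j.
  by rewrite !mxE.
rewrite /mxtrace (bigD1 j) //= ltr_pwDl //; first by rewrite diagE pos.
by apply: sumr_ge0.
Qed.

(** The trace is a combination of the traces of [mxadj X *m rho *m X] and [X *m rho *m mxadj X],
    both positive. The first weight is positive; the second may vanish, at [b = 1]. *)
Lemma tr_betaprod_gt0 b X :
  0 <= b <= 1 -> X != 0 -> 0 < \tr (mxadj X *m betaprod b X).
Proof.
move=> /andP[b_ge0 b_le1] X_neq0.
have adjX_neq0 : mxadj X != 0.
  by apply: contraNneq X_neq0 => adj0; rewrite -[X]mxadjK adj0 /mxadj map_mx0 trmx0.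
have pos1 := tr_pos_def X_neq0; have := tr_pos_def adjX_neq0.
rewrite mxadjK mxtrace_mulC => pos2.
rewrite /betaprod mulmxDr -!scalemxAr linearD !linearZ /= mulmxA.
apply: ltr_pwDl.
  by apply: mulr_gt0 => //; rewrite ltcR; lra.
by apply: mulr_ge0; [rewrite lecR; lra|exact: ltW].
Qed.

Lemma betaprod_eq0 b X : 0 <= b <= 1 -> betaprod b X = 0 -> X = 0.
Proof.
move=> b01 X0; apply/eqP; apply: contraT => /(tr_betaprod_gt0 b01).
by rewrite X0 mulmx0 linear0 ltxx.
Qed.

Lemma betaprod_inj b X Y :
  0 <= b <= 1 -> betaprod b X = betaprod b Y -> X = Y.
Proof.
move=> b01 eqXY; apply/eqP; rewrite -subr_eq0; apply/eqP/(@betaprod_eq0 b) => //.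
by rewrite linearB /= eqXY subrr.
Qed.

(** In finite dimension this follows from injectivity: the matrix [lin_mx] of the map has trivial
    kernel. *)
Lemma betaprod_surj b Y : 0 <= b <= 1 -> exists X, betaprod b X = Y.
Proof.
move=> b01; set A := lin_mx (betaprod b).
have unitA : A \in unitmx.
  rewrite -row_free_unit -kermx_eq0; apply/rowV0P => v /sub_kermxP.
  rewrite mul_rV_lin => v0; rewrite -[v]vec_mxK.
  by rewrite (betaprod_eq0 b01 (_ : betaprod b (vec_mx v) = 0)) ?linear0 //
    -[LHS]mxvecK v0 linear0.
exists (vec_mx (mxvec Y *m invmx A)).
by rewrite -mx_vec_lin vec_mxK mulmxKV // mxvecK.
Qed.

Lemma betaprod_betaLD b Y : 0 <= b <= 1 -> betaprod b (betaLD rho Y b) = Y.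
Proof.
move=> b01; have [X XY] := betaprod_surj Y b01.
exact/esym/(@xgetI _ _ [set L | Y = betaprod b L] X (esym XY)).
Qed.

(** Complex bilinear rather than sesquilinear, so that complex coefficients come out of either
    argument unconjugated; on Hermitian operators it is the real SLD inner product. *)
Definition sld_form X Y : C := \tr (betaprod 0 X *m Y).

Lemma betaprod0E X : betaprod 0 X = (2^-1 : C) *: (rho *m X + X *m rho).
Proof.
rewrite /betaprod addr0 subr0 mul1r scalerDr.
by rewrite (_ : (2^-1)%:C = 2^-1 :> C) // fmorphV rmorph_nat.
Qed.

Lemma sld_formE X Y : sld_form X Y = 2^-1 * (\tr (rho *m X *m Y) + \tr (rho *m Y *m X)).
Proof.
rewrite /sld_form betaprod0E -scalemxAl linearZ /= mulmxDl linearD /=.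
by congr (_ * (_ + _)); rewrite -mulmxA mxtrace_mulC.
Qed.

Lemma sld_formC X Y : sld_form X Y = sld_form Y X.
Proof. by rewrite !sld_formE addrC. Qed.

Lemma sld_form_sumr k X (c : 'I_k -> C) (B : 'I_k -> 'M[C]_n) :
  sld_form X (\sum_j c j *: B j) = \sum_j c j * sld_form X (B j).
Proof.
rewrite /sld_form mulmx_sumr linear_sum; apply: eq_bigr => j _.
by rewrite -scalemxAr linearZ.
Qed.

Lemma sld_form_gt0 X : is_hermitian X -> X != 0 -> 0 < sld_form X X.
Proof.
move=> herX X_neq0; rewrite /sld_form mxtrace_mulC -{1}herX.
by apply: tr_betaprod_gt0; rewrite // lexx ler01.
Qed.

(** Conjugating a trace reverses the product, which exchanges the two terms of [sld_formE]. *)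
Lemma sld_form_real X Y : is_hermitian X -> is_hermitian Y ->
  sld_form X Y = (complex.Re (sld_form X Y))%:C.
Proof.
move=> herX herY; have [her _] := rho_gt0.
have conjE : (sld_form X Y)^* = sld_form X Y.
  have : (2^-1 : C)^* = 2^-1 by rewrite conjc_inv conjc_nat.
  rewrite sld_formE; move: (2^-1 : C) => h hE.
  rewrite rmorphM rmorphD /= hE -!mxtrace_mxadj !mxadjM herX herY her.
  rewrite [in RHS]addrC; congr (_ * (_ + _)).
  - by rewrite mulmxA mxtrace_mulC mulmxA.
  - by rewrite mulmxA mxtrace_mulC mulmxA.
move: conjE; case: (sld_form X Y) => u v [] /eqP; rewrite eq_sym -addr_eq0.
by rewrite -mulr2n mulrn_eq0 /= => /eqP ->.
Qed.

Lemma commopP X :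
  commop rho X *m rho + rho *m commop rho X = im *: (X *m rho - rho *m X).
Proof.
set rhs := RHS; have b01 : 0 <= (0 : R) <= 1 by rewrite lexx ler01.
(* The factor 1/2 is the one by which [betaprod 0] differs from the anticommutator with [rho]. *)
have [Y YE] := betaprod_surj (2^-1 *: rhs) b01.
apply: (@xgetI _ 0 [set Y | Y *m rho + rho *m Y = rhs] Y).
have two : (2 : C) != 0 by rewrite pnatr_eq0.
move: YE; rewrite betaprod0E => /(scalerI (invr_neq0 two)) /= <-.
by rewrite addrC.
Qed.

(** The beta-product exceeds the symmetric one by [b / 2] times the commutator of [rho] and [X],
    which the equation of [commop] turns into an anticommutator. Every beta is thus reduced to the
    SLD case. *)
Lemma betaprod_commop b X :
  betaprod b X = betaprod 0 (X + (im * b%:C) *: commop rho X).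
Proof.
have commE : rho *m X - X *m rho
    = im *: (commop rho X *m rho + rho *m commop rho X).
  by rewrite commopP scalerA -expr2 sqr_i scaleN1r opprB.
have -> : betaprod b X = betaprod 0 X + (b%:C / 2) *: (rho *m X - X *m rho).
  rewrite betaprod0E /betaprod.
  have cE e : ((1 + e) / 2)%:C = 2^-1 + e%:C / 2 :> C.
    by rewrite rmorphM rmorphD fmorphV rmorph_nat rmorph1 mulrDl mul1r.
  rewrite !cE rmorphN; move: (rho *m X) (X *m rho) => P Q.
  by apply/matrixP => i j; rewrite !mxE; ring.
rewrite commE [X + _]addrC betaprod_is_linear [in RHS]addrC !betaprod0E.
move: im (rho *m commop rho X) (commop rho X *m rho) => z P Q.
by congr (_ + _); apply/matrixP => i j; rewrite !mxE; ring.
Qed.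

(** The left side is [im / 2] times the difference of [\tr (X *m rho *m Y)] and
    [\tr (rho *m X *m Y)]; by cyclicity, swapping [X] and [Y] exchanges these traces. *)
Lemma sld_form_commop X Y :
  sld_form (commop rho X) Y = - sld_form X (commop rho Y).
Proof.
have formE U V : sld_form (commop rho U) V
    = 2^-1 * (im * (\tr (U *m rho *m V) - \tr (rho *m U *m V))).
  have UE : betaprod 0 (commop rho U) = 2^-1 *: (im *: (U *m rho - rho *m U)).
    by rewrite betaprod0E -commopP; congr (_ *: _); apply: addrC.
  rewrite /sld_form UE; move: im => z.
  by rewrite -!scalemxAl !mxtraceZ mulmxBl [\tr (_ - _)]raddfB.
rewrite [in RHS]sld_formC !formE.
have -> : \tr (Y *m rho *m X) = \tr (rho *m X *m Y).
  by rewrite -mulmxA mxtrace_mulC.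
have -> : \tr (rho *m Y *m X) = \tr (X *m rho *m Y).
  by rewrite mxtrace_mulC mulmxA.
by rewrite -!mulrN opprB.
Qed.

End Fixed.
End BetaProduct.

(** * Real spans of Hermitian operators and orthogonality in codimension one *)

Section RealSpan.
Set Implicit Arguments. Unset Strict Implicit. Unset Printing Implicit Defensive.
Local Open Scope complex_scope.
Variables (R : realType) (n : nat).
Local Notation C := (R[i]).

(** Coefficients form a row vector, so that a change of spanning family is a matrix product. *)
Definition rcomb k (c : 'rV[R]_k) (B : 'I_k -> 'M[C]_n) : 'M[C]_n :=
  \sum_(j < k) (c 0 j)%:C *: B j.

Lemma in_rspanP k (B : 'I_k -> 'M[C]_n) X :
  in_rspan B X <-> exists c, X = rcomb c B.
Proof.
split=> [[c ->]|[c ->]]; last by exists (c 0).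
by exists (\row_j c j); apply: eq_bigr => j _; rewrite mxE.
Qed.

Lemma rfree_rcomb k (B : 'I_k -> 'M[C]_n) c :
  rfree B -> rcomb c B = 0 -> c = 0.
Proof. by move=> freeB /freeB c0; apply/rowP => j; rewrite c0 mxE. Qed.

Lemma rcombD k (B : 'I_k -> 'M[C]_n) c1 c2 :
  rcomb (c1 + c2) B = rcomb c1 B + rcomb c2 B.
Proof.
by rewrite /rcomb -big_split; apply: eq_bigr => j _; rewrite mxE rmorphD scalerDl.
Qed.

Lemma rcomb0 k (B : 'I_k -> 'M[C]_n) : rcomb 0 B = 0.
Proof. by apply: big1 => j _; rewrite mxE scale0r. Qed.

Lemma rcombM m k (u : 'rV[R]_m) (A : 'M[R]_(m, k)) (B : 'I_k -> 'M[C]_n) :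
  rcomb (u *m A) B = rcomb u (fun j => rcomb (row j A) B).
Proof.
rewrite /rcomb; under [RHS]eq_bigr do rewrite scaler_sumr.
rewrite exchange_big; apply: eq_bigr => j _.
rewrite mxE rmorph_sum scaler_suml; apply: eq_bigr => i _.
by rewrite scalerA rmorphM mxE.
Qed.

Variable rho : 'M[C]_n.
Hypothesis rho_gt0 : pos_def rho.
Local Notation sld := (sld_form rho).

Lemma sld_rcombr k X (c : 'rV[R]_k) B :
  sld X (rcomb c B) = \sum_j (c 0 j)%:C * sld X (B j).
Proof. exact: sld_form_sumr. Qed.

Lemma sld_formDr X Y Z : sld X (Y + Z) = sld X Y + sld X Z.
Proof. by rewrite /sld_form mulmxDr linearD. Qed.

Lemma sld_formZr X a Y : sld X (a *: Y) = a * sld X Y.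
Proof. by rewrite /sld_form -scalemxAr linearZ. Qed.

(** A row vector [v] in the kernel yields a Hermitian [rcomb v L] of zero SLD norm, hence zero, and
    freeness gives [v = 0]. *)
Lemma gram_unit k (L : 'I_k -> 'M[C]_n) :
  (forall j, is_hermitian (L j)) -> rfree L ->
  (\matrix_(i, j) complex.Re (sld (L i) (L j))) \in unitmx.
Proof.
move=> herL freeL; rewrite -row_free_unit -kermx_eq0.
apply/rowV0P => v /sub_kermxP vK; apply: (rfree_rcomb freeL).
have herX : is_hermitian (rcomb v L) by apply: mxadj_rsum.
apply/eqP; apply: contraT => /(sld_form_gt0 rho_gt0 herX).
rewrite {2}/rcomb sld_form_sumr big1 ?ltxx // => j _.
rewrite sld_formC sld_rcombr.
have := congr1 (fun M : 'rV_k => M 0 j) vK; rewrite !mxE => vK0.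
rewrite (_ : \sum_(i < k) _ = (\sum_i v 0 i * complex.Re (sld (L i) (L j)))%:C).
  rewrite (_ : \sum_i _ = 0) ?mulr0 // -[RHS]vK0.
  by apply: eq_bigr => i _; rewrite mxE.
rewrite rmorph_sum; apply: eq_bigr => i _.
by rewrite rmorphM /= -sld_form_real // sld_formC.
Qed.

(** Orthogonality to the [L i] is [d] equations in [d.+1] coordinates, so a nonzero solution [e]
    exists. The [L i] together with [e] are then [d.+1] independent vectors, hence a basis. *)
Lemma codim1_orthogonal d (L : 'I_d -> 'M[C]_n) (B : 'I_d.+1 -> 'M[C]_n) :
  (forall k, is_hermitian (B k)) -> rfree B -> (forall i, in_rspan B (L i)) ->
  (forall i, is_hermitian (L i)) -> rfree L ->
  exists e, [/\ is_hermitian e, e != 0, in_rspan B e,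
    forall i, sld (L i) e = 0 &
    forall X, in_rspan B X ->
      exists ch : 'rV[R]_d * R, X = rcomb ch.1 L + ch.2%:C *: e].
Proof.
move=> herB freeB LB herL freeL.
set P := \matrix_(k < d.+1, i < d) complex.Re (sld (L i) (B k)).
have kerP : kermx P != 0.
  rewrite kermx_eq0 /row_free; apply/negP => /eqP rkP.
  by have := rank_leq_col P; rewrite rkP ltnn.
have [v /sub_kermxP vP v_neq0] := rowV0Pn kerP.
pose e := rcomb v B.
have here : is_hermitian e by apply: mxadj_rsum.
have e_neq0 : e != 0 by apply: contraNneq v_neq0 => /(rfree_rcomb freeB)/eqP.
have Le i : sld (L i) e = 0.
  have := congr1 (fun M : 'rV_d => M 0 i) vP; rewrite !mxE => vP0.
  rewrite sld_rcombr (_ : \sum_j _ = (\sum_k v 0 k * P k i)%:C); first by rewrite vP0.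
  rewrite rmorph_sum; apply: eq_bigr => k _.
  by rewrite rmorphM /= mxE -sld_form_real.
have ee : sld e e != 0 by rewrite gt_eqF // sld_form_gt0.
have /choice[Q LQ] i : exists c, L i = rcomb c B by apply/in_rspanP.
pose A := col_mx (\matrix_(i < d) Q i) v.
have combA (u1 : 'rV_d) (u2 : 'rV_1) :
    rcomb (row_mx u1 u2 *m A) B = rcomb u1 L + (u2 0 0)%:C *: e.
  rewrite mul_row_col rcombD !rcombM; congr (_ + _).
    by apply: eq_bigr => i _; rewrite rowK LQ.
  by rewrite /rcomb big_ord1 row_id.
have freeA : row_free A.
  rewrite -kermx_eq0; apply/rowV0P => u /sub_kermxP.
  rewrite -[u]hsubmxK; move: (lsubmx u) (rsubmx u) => u1 u2 uA.
  have := combA u1 u2; rewrite uA rcomb0 => /esym comb0.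
  (* Pairing with [e] isolates its coefficient, since [e] is orthogonal to every [L i]. *)
  have u20 : u2 0 0 = 0.
    have : sld e (rcomb u1 L + (u2 0 0)%:C *: e) = 0.
      by rewrite comb0 /sld_form mulmx0 linear0.
    rewrite sld_formDr sld_formZr sld_rcombr big1 ?add0r; last first.
      by move=> j _; rewrite sld_formC Le mulr0.
    by move=> /eqP; rewrite mulf_eq0 (negPf ee) orbF => /eqP/complexI.
  move: comb0; rewrite u20 scale0r addr0 => /(rfree_rcomb freeL) ->.
  by rewrite [u2]mx11_scalar u20 raddf0 row_mx0.
have fullA : row_full A by rewrite /row_full (eqP freeA) addn1.
exists e; split=> // [|X /in_rspanP[c ->]]; first by apply/in_rspanP; exists v.
have /submxP[u ->] := submx_full c fullA.
by exists (lsubmx u, rsubmx u 0 0); rewrite -[u in LHS]hsubmxK combA.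
Qed.

End RealSpan.

(** * The inverse of the beta Fisher information matrix *)

Section InverseFisher.
Set Implicit Arguments. Unset Strict Implicit. Unset Printing Implicit Defensive.
Local Open Scope complex_scope.
Variables (R : realType) (n d : nat).
Local Notation C := (R[i]).
Local Notation im := (0 +i* 1 : C).

(* In the basis dual to the SLDs, the commutation operator has blocks [F]
   (inside the tangent space) and [g] (towards the extra direction [e], of
   squared length [t]); the formula is the Schur complement along [e]. *)
Lemma inv_Jbeta (rho : 'M[C]_n) (D : 'I_d -> 'M[C]_n) (B : 'I_d.+1 -> 'M[C]_n) :
  pos_def rho -> rfree (fun k => betaLD rho (D k) 0) ->
  (forall k, is_hermitian (B k)) -> rfree B ->
  (forall k, in_rspan B (betaLD rho (D k) 0)) ->
  (forall X, in_rspan B X -> in_rspan B (commop rho X)) ->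
  exists (K F : 'M[R]_d) (g : 'cV[R]_d) (t : R), 0 < t /\
    forall b, 0 <= b <= 1 ->
      Defs.ReM (invmx (Jbeta rho D b)) = K - (b ^+ 2 * t) *: (g *m g^T) /\
      Defs.ImM (invmx (Jbeta rho D b)) = b *: F.
Proof.
move=> rho_gt0; set L := fun k => betaLD rho (D k) 0.
move=> freeL herB freeB LB stabB.
have b001 : 0 <= (0 : R) <= 1 by rewrite lexx ler01.
have SL j : betaprod rho 0 (L j) = D j by apply: betaprod_betaLD.
have herL i : is_hermitian (L i).
  by have /in_rspanP[c cE] := LB i; rewrite /L cE; apply: mxadj_rsum.
have [e [here e_neq0 eB Le spanB]] :=
  codim1_orthogonal rho_gt0 herB freeB LB herL freeL.
have eL i : sld_form rho e (L i) = 0 by rewrite sld_formC Le.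
pose t := complex.Re (sld_form rho e e).
have tE : sld_form rho e e = t%:C by apply: sld_form_real.
have t_gt0 : 0 < t by rewrite -ltcR -tE; apply: sld_form_gt0.
set K0 := \matrix_(i, j) complex.Re (sld_form rho (L i) (L j)).
have unitK0 : K0 \in unitmx by apply: gram_unit.
pose K := invmx K0.
have K0E i j : sld_form rho (L i) (L j) = (K0 i j)%:C.
  by rewrite mxE; apply: sld_form_real.
pose dualL k := \sum_j (K j k)%:C *: L j.
have Ldual i k : sld_form rho (L i) (dualL k) = (i == k)%:R.
  rewrite sld_form_sumr.
  have := congr1 (fun M : 'M[R]_d => (M i k)%:C : C) (mulmxV unitK0).
  rewrite !mxE rmorph_nat rmorph_sum => <-; apply: eq_bigr => j _.
  by rewrite rmorphM /= -K0E mulrC.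
have dualLB k : in_rspan B (dualL k).
  apply/in_rspanP.
  have /choice[Q LQ] i : exists c, L i = rcomb c B by apply/in_rspanP/LB.
  exists ((\row_j K j k) *m (\matrix_i Q i)); rewrite rcombM.
  by apply: eq_bigr => j _; rewrite rowK -LQ mxE.
(* Splits the image of [dualL k] into its tangent part, column [k] of [F], and its component [g k 0]
   along [e]. *)
have /choice[fg fgE] k := spanB _ (stabB _ (dualLB k)).
have [[h0 h1] /= hE] := spanB _ (stabB _ eB).
pose F := \matrix_(j, k) (fg k).1 0 j; pose g := \col_k (fg k).2.
(* Skewness: the image of [e] is orthogonal to [e]. *)
have eDe : h1 = 0.
  have := sld_form_commop rho_gt0 e e; rewrite sld_formC hE => /eqP.
  rewrite -addr_eq0 -mulr2n mulrn_eq0 /= sld_formDr sld_formZr sld_rcombr big1.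
    rewrite add0r mulf_eq0 tE => /orP[/eqP/complexI //|/eqP/complexI t0].
    by rewrite t0 ltxx in t_gt0.
  by move=> j _; rewrite eL mulr0.
(* Skewness again: pairing with [dualL k] reads off the coefficient of [L k], and moving the
   operator across leaves [g k 0] times the squared length [t] of [e]. *)
have h0E k : h0 0 k = - (t * g k 0).
  have := sld_form_commop rho_gt0 e (dualL k).
  rewrite hE eDe scale0r addr0 fgE sld_formDr sld_formZr sld_rcombr big1; last first.
    by move=> j _; rewrite eL mulr0.
  rewrite sld_formC sld_rcombr (bigD1 k) //= sld_formC Ldual eqxx mulr1 big1; last first.
    by move=> j /negPf jk; rewrite sld_formC Ldual jk mulr0.
  rewrite addr0 add0r tE -rmorphM -rmorphN => /complexI ->.
  by rewrite mxE mulrC.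
have eDual k : sld_form rho (dualL k) e = 0.
  by rewrite sld_formC sld_form_sumr big1 // => j _; rewrite eL mulr0.
exists K, F, g, t; split=> // b b01.
(* Column [k] lists the coordinates in [L] of the image of [dualL k - (im * b%:C * (g k 0)%:C) *: e]
   under 1 + i b D, where D is [commop rho0] with [rho0] the fixed [rho]; the multiple of [e] is
   chosen to cancel the [e] component of that image. *)
pose N := \matrix_(j, k)
  ((K j k)%:C + (im * b%:C) * (F j k)%:C - (b ^+ 2 * t * (g j 0 * g k 0))%:C : C).
have NE k : \sum_j N j k *: betaLD rho (D j) b
    = dualL k - (im * b%:C * (g k 0)%:C) *: e.
  apply: (betaprod_inj rho_gt0 b01).
  have -> : betaprod rho b (\sum_j N j k *: betaLD rho (D j) b)
      = betaprod rho 0 (\sum_j N j k *: L j).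
    rewrite !linear_sum; apply: eq_bigr => j _.
    by rewrite !linearZ /= betaprod_betaLD // SL.
  rewrite [RHS]linearB [X in _ = _ - X]linearZ /= !(betaprod_commop rho_gt0 b).
  rewrite -linearZ -linearB /=; congr betaprod.
  have -> : \sum_j N j k *: L j = dualL k + (im * b%:C) *: rcomb (fg k).1 L
      + (im * b%:C * (im * b%:C) * (g k 0)%:C * - 1) *: rcomb h0 L.
    rewrite /dualL /rcomb !scaler_sumr -!big_split; apply: eq_bigr => j _ /=.
    rewrite !scalerA -!scalerDl; congr (_ *: _); rewrite h0E !mxE.
    have -> : im * b%:C * (im * b%:C) = - (b ^+ 2)%:C.
      by rewrite mulrACA -expr2 sqr_i mulN1r rmorphXn.
    by rewrite -!(rmorphM, rmorphN) /=; congr (_ + _); rewrite -?rmorphN;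
       congr (_%:C); ring.
  rewrite fgE hE eDe scale0r addr0 [g k 0]mxE.
  move: (dualL k) (rcomb _ _) (rcomb _ _) => X Y Z.
  by apply/matrixP => i j; rewrite !mxE; ring.
(* The entries of [Jbeta] are the pairings of [L i] with the beta derivatives; in [NE] the term in
   [e] is invisible to [L i], which leaves the duality relation. *)
have JN : Jbeta rho D b *m N = 1%:M.
  apply/matrixP => i k; rewrite !mxE.
  have : sld_form rho (L i) (\sum_j N j k *: betaLD rho (D j) b) = (i == k)%:R.
    rewrite NE -scaleNr sld_formDr sld_formZr Le mulr0 addr0; exact: Ldual.
  rewrite sld_form_sumr => <-; apply: eq_bigr => j _.
  by rewrite mxE mulrC /sld_form SL.
have unitJ : Jbeta rho D b \in unitmx by have [] := mulmx1_unit JN.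
have -> : invmx (Jbeta rho D b) = N.
  by rewrite -[LHS]mulmx1 -JN mulKmx.
split; apply/matrixP => i j; last by rewrite !mxE /=; ring.
by rewrite !mxE /= big_ord1 !mxE; ring.
Qed.

End InverseFisher.

(** * Concave quadratics and the maximum over beta *)

(** The condition [2 * q <= c] places the vertex at or beyond 1 without dividing, so that the affine
    case [q = 0] is included. *)
Lemma concave_quadratic_le1 (R : realType) (A c q b : R) :
  0 <= q -> 2 * q <= c -> b <= 1 ->
  A - b ^+ 2 * q + b * c <= A - q + c.
Proof.
move=> q_ge0 cq b_le1; rewrite -subr_ge0.
have -> : A - q + c - (A - b ^+ 2 * q + b * c)
    = (1 - b) * (c - 2 * q) + q * (1 - b) ^+ 2 by ring.
by apply: addr_ge0; apply: mulr_ge0; rewrite ?subr_ge0 ?sqr_ge0.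
Qed.

Lemma concave_quadratic_le_vertex (R : realType) (A c q b : R) : 0 < q ->
  A - b ^+ 2 * q + b * c
    <= A - (c / (2 * q)) ^+ 2 * q + (c / (2 * q)) * c.
Proof.
move=> q_gt0; rewrite -subr_ge0.
have -> : A - (c / (2 * q)) ^+ 2 * q + (c / (2 * q)) * c
    - (A - b ^+ 2 * q + b * c) = q * (b - c / (2 * q)) ^+ 2.
  by field; rewrite gt_eqF.
by rewrite mulr_ge0 ?sqr_ge0 ?ltW.
Qed.

Lemma Re_mxtrace_cmx (R : realType) n (G : 'M[R]_n) (A : 'M[R[i]]_n) :
  complex.Re (\tr (cmx G *m A)) = \tr (G *m Defs.ReM A).
Proof.
rewrite /mxtrace raddf_sum; apply: eq_bigr => i _.
rewrite !mxE raddf_sum; apply: eq_bigr => j _.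
by rewrite !mxE /=; case: (A j i) => u v /=; rewrite mul0r subr0.
Qed.

Lemma cmxB (R : realType) m n (A B : 'M[R]_(m, n)) :
  cmx (A - B) = cmx A - cmx B.
Proof.
apply/matrixP => i j; rewrite !mxE; apply/eqP.
by rewrite eq_complex /= subr0 !eqxx.
Qed.

Theorem theorem6 (R : realType) (n d : nat) (Theta : set 'rV[R]_d)
  (rho : 'rV[R]_d -> 'M[R[i]]_n) (theta0 : 'rV[R]_d) (G : 'M[R]_d) :
  open (Theta : set ('rV[R]_d : normedModType R)) -> Theta theta0 ->
  (forall th, Theta th -> density (rho th)) ->
  (forall th, Theta th -> forall a b,
      differentiable (fun t : 'rV[R]_d => complex.Re (rho t a b)) (th : 'rV[R]_d : normedModType R) /\
      differentiable (fun t : 'rV[R]_d => complex.Im (rho t a b)) (th : 'rV[R]_d : normedModType R)) ->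
  pos_def (rho theta0) ->
  rfree (fun k => betaLD (rho theta0) (pderiv rho theta0 k) 0) ->
  (exists B : 'I_d.+1 -> 'M[R[i]]_n,
      [/\ forall k, is_hermitian (B k),
          rfree B,
          forall k, in_rspan B (betaLD (rho theta0) (pderiv rho theta0 k) 0)
        & forall X, in_rspan B X -> in_rspan B (commop (rho theta0) X)]) ->
  rpos_def G ->
  let C := Cbeta (rho theta0) (pderiv rho theta0) G in
  let bh := betahat (rho theta0) (pderiv rho theta0) G in
  let M := if (1 <= bh)%E then C 1 else C (fine bh) in
  (forall beta, 0 <= beta <= 1 -> C beta <= M) /\
  (exists2 beta, 0 <= beta <= 1 & C beta = M).
Proof.
move=> _ _ _ _ rho_gt0 freeL [B [herB freeB LB stabB]] [_ posG].
set D := pderiv rho theta0 in freeL LB *; move: (rho theta0) rho_gt0 freeL LB stabB.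
move=> rho0 rho_gt0 freeL LB stabB C bh M.
(* [J] is kept abstract: unification would otherwise try to convert
   [Jbeta rho0 D 0] with [Jbeta rho0 D 1]. *)
have [J JJ] : exists J, forall b, invmx (Jbeta rho0 D b) = J b by eexists.
have [K [F [g [t [t_gt0 JE]]]]] := inv_Jbeta rho_gt0 freeL herB freeB LB stabB.
have {}JE b (b01 : 0 <= b <= 1) :
    Defs.ReM (J b) = K - (b ^+ 2 * t) *: (g *m g^T) /\ Defs.ImM (J b) = b *: F.
  by rewrite -JJ; apply: JE.
have b001 : 0 <= (0 : R) <= 1 by rewrite lexx ler01.
have b101 : 0 <= (1 : R) <= 1 by rewrite lexx ler01.
set c := trabs (sqrtm G *m F *m sqrtm G).
have c_ge0 : 0 <= c by apply: trabs_ge0.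
(* This is the trace of [G] times the drop from the inverse SLD matrix to the real part of the
   inverse RLD matrix; the vertex is then [c / (2 * q)]. *)
pose q := t * (g^T *m G *m g) 0 0.
have trq : \tr (G *m (g *m g^T)) = (g^T *m G *m g) 0 0.
  by rewrite mulmxA mxtrace_mulC mulmxA /mxtrace big_ord1.
have CE b : 0 <= b <= 1 -> C b = \tr (G *m K) - b ^+ 2 * q + b * c.
  move=> b01; have [ReE ImE] := JE b b01.
  rewrite /C /Cbeta /= JJ Re_mxtrace_cmx ReE ImE mulmxBr linearB /=.
  rewrite -!scalemxAr mxtraceZ trq /q -scalemxAl trabsZ; last by case/andP: b01.
  by rewrite mulrA.
have [Re0 Im0] := JE 0 b001; have [] := JE 1 b101.
rewrite expr1n mul1r scale1r => Re1 Im1.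
(* The inverse SLD matrix is real because its imaginary part is [0 *: F]; [betahat] compares complex
   matrices, so this has to be known. *)
have J0E : J 0 = cmx K.
  apply/matrixP => i j; rewrite [RHS]mxE.
  move/matrixP/(_ i j): Re0; move/matrixP/(_ i j): Im0.
  rewrite !mxE; case: (J 0 i j) => u v /= -> ->.
  by rewrite expr0n /= !mul0r subr0.
have J1E : J 0 - cmx (Defs.ReM (J 1))
    = cmx (t *: (g *m g^T)).
  rewrite J0E Re1 -cmxB.
  by rewrite opprB addrC subrK.
have bhE : bh = if g != 0 then (c / (2 * q))%:E else +oo%E.
  have -> : bh = if J 0 != cmx (Defs.ReM (J 1)) then
      (trabs (sqrtm G *m Defs.ImM (J 1) *m sqrtm G)
        / (2 * complex.Re (\tr (cmx G *m (J 0 - cmx (Defs.ReM (J 1)))))))%:E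
    else +oo%E by rewrite -(JJ 0) -(JJ 1).
  rewrite -subr_eq0 J1E.
  (* The diagonal of [g *m g^T] consists of the squares of the entries of [g], and [t > 0]: the
     infinite case of [betahat] is exactly [g = 0]. *)
  have -> : (cmx (t *: (g *m g^T)) != 0) = (g != 0).
    congr (~~ _); apply/eqP/eqP => [/matrixP gg|->]; last first.
      by rewrite mul0mx scaler0; apply/matrixP => i j; rewrite !mxE.
    apply/matrixP => i j; rewrite (ord1 j) mxE; apply/eqP.
    have := gg i i; rewrite !mxE big_ord1 !mxE => -[/eqP].
    by rewrite mulf_eq0 gt_eqF //= mulf_eq0 orbb.
  rewrite Im1 -/c Re_mxtrace_cmx.
  have -> : Defs.ReM (cmx (t *: (g *m g^T))) = t *: (g *m g^T).
    by apply/matrixP => i j; rewrite !mxE.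
  by rewrite -scalemxAr mxtraceZ trq.
(* If [g = 0] the bound is affine in beta with slope [c >= 0], hence largest at 1. *)
have [g0|g_neq0] := eqVneq g 0.
  have -> : M = C 1 by rewrite /M bhE g0 eqxx leey.
  have q0 : q = 0 by rewrite /q g0 mulmx0 mxE mulr0.
  split=> [b b01|]; last by exists 1.
  rewrite !CE // expr1n !mul1r; have /andP[_ b_le1] := b01.
  by apply: concave_quadratic_le1; rewrite // q0 ?mulr0.
(* Positive definiteness of [G] makes the quadratic strictly concave, so the quotient in [betahat]
   is a genuine vertex. *)
have q_gt0 : 0 < q by rewrite mulr_gt0 // posG.
have ME : M = if 1 <= c / (2 * q) then C 1 else C (c / (2 * q)).
  by rewrite /M bhE g_neq0 lee_fin.
rewrite {}ME; case: leP => [bh_ge1|bh_lt1].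
  split=> [b b01|]; last by exists 1.
  rewrite !CE // expr1n !mul1r; have /andP[_ b_le1] := b01.
  apply: concave_quadratic_le1 => //; first exact: ltW.
  by move: bh_ge1; rewrite ler_pdivlMr ?mul1r // mulr_gt0.
have bh01 : 0 <= c / (2 * q) <= 1.
  by rewrite (ltW bh_lt1) andbT divr_ge0 // mulr_ge0 // ltW.
split=> [b b01|]; last by exists (c / (2 * q)).
by rewrite !CE //; apply: concave_quadratic_le_vertex.
Qed.
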